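(* Let $((A,[\ ,\ ]_A,\cdot_A),(A^*,[\ ,\ ]_{A^*},\cdot_{A^*}))$ be a Poisson bialgebra and let $(\mathfrak A=A\oplus A^*,[\ ,\ ]_{\mathfrak A},\cdot_{\mathfrak A})$ be its Drinfeld classical double. Let $\{e_1,\dots,e_n\}$ be a basis of $A$ with dual basis $\{e_1^*,\dots,e_n^*\}$ of $A^*$, and let $r=\sum_i e_i\otimes e_i^*\in A\otimes A^*\subset\mathfrak A\otimes\mathfrak A$. Then the Poisson bialgebra $(\mathfrak A,[\ ,\ ]_{\mathfrak A},\cdot_{\mathfrak A},\delta_r,\Delta_r)$ is a quasi-triangular Poisson bialgebra. Furthermore, it is factorizable.
   Context: All vector spaces are finite-dimensional over a field $\mathbb K$ of characteristic $0$; algebras need not be unital. A Poisson algebra $(A,[\ ,\ ]_A,\cdot_A)$ is a Lie algebra and a commutative associative algebra on the same space with $[a,b\cdot_A c]_A=[a,b]_A\cdot_A c+b\cdot_A[a,c]_A$. Write $\mathrm{ad}(a)b=[a,b]_A$, $L(a)b=a\cdot_A b$, and $\mathrm{ad}^*(a)=(\mathrm{ad}(a))^*$, $L^*(a)=(L(a))^*$ for the transposed maps (no sign); subscripts indicate the algebra, e.g. $\mathrm{ad}_{[,]_{A^*}}^*(x^* ):A\to A$ is the transpose of $y^*\mapsto[x^*,y^*]_{A^*}$ under $A^{**}=A$. Poisson bialgebra: a pair of Poisson algebras $(A,[\ ,\ ]_A,\cdot_A)$, $(A^*,[\ ,\ ]_{A^*},\cdot_{A^*})$ such that, with $\delta,\Delta:A\to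 A\otimes A$ given by $\langle\delta(a),x^*\otimes y^*\rangle=\langle a,[x^*,y^*]_{A^*}\rangle$, $\langle\Delta(a),x^*\otimes y^*\rangle=\langle a,x^*\cdot_{A^*}y^*\rangle$, for all $a,b\in A$: $\delta([a,b]_A)=(\mathrm{ad}(a)\otimes\mathrm{id}+\mathrm{id}\otimes\mathrm{ad}(a))\delta(b)-(\mathrm{ad}(b)\otimes\mathrm{id}+\mathrm{id}\otimes\mathrm{ad}(b))\delta(a)$; $\Delta(a\cdot_A b)=(L(a)\otimes\mathrm{id})\Delta(b)+(\mathrm{id}\otimes L(b))\Delta(a)$; $\delta(a\cdot_A b)=(L(a)\otimes\mathrm{id})\delta(b)+(L(b)\otimes\mathrm{id})\delta(a)+(\mathrm{id}\otimes\mathrm{ad}(a))\Delta(b)+(\mathrm{id}\otimes\mathrm{ad}(b))\Delta(a)$; $\Delta([a,b]_A)=(\mathrm{ad}(a)\otimes\mathrm{id}+\mathrm{id}\otimes\mathrm{ad}(a))\Delta(b)+(L(b)\otimes\mathrm{id}-\mathrm{id}\otimes L(b))\delta(a)$. It is also denoted $(A,[\ ,\ ]_A,\cdot_A,\delta,\Delta)$. Drinfeld classical double: the space $\mathfrak A=A\oplus A^*$ with $[(a,x^* ),(b,y^* )]_{\mathfrak A}=([a,b]_A-\mathrm{ad}_{[,]_{A^*}}^*(x^* )b+\mathrm{ad}_{[,]_{A^*}}^*(y^* )a,\ [x^*,y^*]_{A^*}-\mathrm{ad}_{[,]_A}^*(a)y^*+\mathrm{ad}_{[,]_A}^*(b)x^*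 )$, $(a,x^* )\cdot_{\mathfrak A}(b,y^* )=(a\cdot_A b+L_{\cdot_{A^*}}^*(x^* )b+L_{\cdot_{A^*}}^*(y^* )a,\ x^*\cdot_{A^*}y^*+L_{\cdot_A}^*(a)y^*+L_{\cdot_A}^*(b)x^* )$. It is known that $\mathfrak A$ is a Poisson algebra and that $(\mathfrak A,[\ ,\ ]_{\mathfrak A},\cdot_{\mathfrak A},\delta_r,\Delta_r)$ is a Poisson bialgebra. For a Poisson algebra $B$ and $r=\sum_i a_i\otimes b_i\in B\otimes B$ put $\delta_r(u)=(\mathrm{id}\otimes\mathrm{ad}(u)+\mathrm{ad}(u)\otimes\mathrm{id})(r)$, $\Delta_r(u)=(\mathrm{id}\otimes L(u)-L(u)\otimes\mathrm{id})(r)$. $r$ is a solution of the Poisson Yang-Baxter equation in $B$ if $\mathbf C(r)=\mathbf A(r)=0$, where $\mathbf C(r)=\sum_{i,j}([a_i,a_j]\otimes b_i\otimes b_j+a_i\otimes a_j\otimes[b_i,b_j]+a_i\otimes[b_i,a_j]\otimes b_j)$, $\mathbf A(r)=\sum_{i,j}(a_i\cdot a_j\otimes b_i\otimes b_j+a_i\otimes a_j\otimes b_i\cdot b_j-a_i\otimes a_j\cdot b_i\otimes b_j)$. $s\in B\otimes B$ is $(\mathrm{ad},L)$-invariant if $(\mathrm{ad}(u)\otimes\mathrm{id}+\mathrm{id}\otimes\mathrm{ad}(u))(s)=0=(L(u)\otimes\mathrm{id}-\mathrm{id}\otimes L(u))(s)$ for all $u\in B$. The Poisson bialgebra $(B,[\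 ,\ ],\cdot,\delta_r,\Delta_r)$ is quasi-triangular if $r$ solves the Poisson Yang-Baxter equation and its symmetric part $\frac12(r+\tau(r))$ ($\tau$ the flip) is $(\mathrm{ad},L)$-invariant; it is factorizable if moreover this symmetric part is nondegenerate, i.e. $I_r=r_+-r_-:B^*\to B$ is a linear isomorphism, where $\langle r_+(x),y\rangle=-\langle x,r_-(y)\rangle=\langle r,x\otimes y\rangle$ for $x,y\in B^*$. *)

(* Defs.v *)
From HB Require Import structures.
From mathcomp Require Import all_boot all_order all_algebra.

Set Implicit Arguments.
Unset Strict Implicit.
Unset Printing Implicit Defensive.

Import GRing.Theory.
Local Open Scope ring_scope.

(* Bilinear maps U x V -> W are elements of 'Hom(U, 'Hom(V, W)).  A product m *)
(* on A has type 'Hom(A, 'End(A)), so that m a is the left multiplication by  *)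
(* a, i.e. ad(a) for a bracket and L(a) for a commutative product.            *)

Section Bilinear.
Variables (K : fieldType) (U V W : vectType K).

Definition bilfun (f : U -> V -> W) : 'Hom(U, 'Hom(V, W)) :=
  linfun (fun u => linfun (f u)).

(* linfun agrees with its argument only on linear maps, hence the lemmas of   *)
(* this form below, which check the linearity in each use.                    *)
Lemma linfunE (f : U -> W) : linear f -> linfun f =1 f.
Proof.
by move=> f_lin u; pose fL := GRing.isLinear.Build _ _ _ _ f f_lin;
   pose F : {linear U -> W} := HB.pack f fL; exact: (lfunE F).
Qed.

End Bilinear.

Lemma bilfunE (K : fieldType) (U V W : vectType K) (f : U -> V -> W) :
    (forall v, linear (f^~ v)) -> (forall u, linear (f u)) ->
  forall u v, bilfun f u v = f u v.
Proof.
move=> fl fr u v; rewrite linfunE => [|a x y]; first by rewrite linfunE.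
by apply/lfunP => z; rewrite add_lfunE scale_lfunE !linfunE // fl.
Qed.

Section Dual.
Variable K : fieldType.

Definition vdual (V : vectType K) : vectType K := 'Hom(V, K^o).

Definition transpose (V W : vectType K) (f : 'Hom(V, W)) :
  'Hom(vdual W, vdual V) := linfun (fun x : vdual W => (x \o f)%VF).

Lemma transposeE (V W : vectType K) (f : 'Hom(V, W)) (x : vdual W) (v : V) :
  transpose f x v = x (f v).
Proof.
rewrite linfunE ?comp_lfunE // => k x1 x2; apply/lfunP => z.
by rewrite !(comp_lfunE, add_lfunE, scale_lfunE).
Qed.

(* The canonical isomorphism V -> V^**                                        *)
Definition bidual (V : vectType K) : 'Hom(V, vdual (vdual V)) :=
  bilfun (fun (v : V) (x : vdual V) => x v : K^o).

Lemma bidualE (V : vectType K) (v : V) (x : vdual V) : bidual V v x = x v.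
Proof.
rewrite bilfunE // => [y k v1 v2|w k x1 x2]; first by rewrite linearP.
by rewrite add_lfunE scale_lfunE.
Qed.

(* The transpose of an endomorphism of V^*, read on V = V^**                  *)
Definition transpose_dual (V : vectType K) (f : 'End(vdual V)) : 'End(V) :=
  ((bidual V)^-1 \o (transpose f \o bidual V))%VF.

Lemma lker_bidual (V : vectType K) : lker (bidual V) = 0%VS.
Proof.
apply/eqP; rewrite -subv0; apply/subvP => v; rewrite memv_ker memv0 => /eqP v0.
rewrite [v](coord_vbasis (memvf v)) big1 // => i _.
pose x : vdual V := linfun (coord (vbasis {:V}) i : V -> K^o).
have xE w : x w = coord (vbasis {:V}) i w.
  by rewrite /x linfunE // => k a b; rewrite linearP.
by rewrite -xE -bidualE v0 zero_lfunE scale0r.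
Qed.

Lemma limg_bidual (V : vectType K) : limg (bidual V) = fullv.
Proof.
apply/eqP; rewrite eqEdim subvf /= limg_dim_eq ?lker_bidual ?capv0 //.
have -> : \dim {:vdual (vdual V)} = (\dim {:V} * 1 * 1)%N by rewrite !dimvf.
by rewrite !muln1.
Qed.

Lemma transpose_dualE (V : vectType K) (f : 'End(vdual V)) (v : V)
  (x : vdual V) : x (transpose_dual f v) = f x v.
Proof.
rewrite -bidualE !comp_lfunE limg_lfunVK ?limg_bidual ?memvf //.
by rewrite transposeE bidualE.
Qed.

Lemma transpose_linear (V W : vectType K) : linear (@transpose V W).
Proof.
move=> k f g; apply/lfunP => x; apply/lfunP => v.
by rewrite !(transposeE, add_lfunE, scale_lfunE) linearP.
Qed.

Lemma transpose_dual_linear (V : vectType K) : linear (@transpose_dual V).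
Proof.
move=> k f g; rewrite /transpose_dual transpose_linear.
by rewrite comp_lfunDl comp_lfunDr -comp_lfunZl -comp_lfunZr.
Qed.

Definition dual_basis n (V : vectType K) (e : n.-tuple V) (i : 'I_n) :
  vdual V := linfun (coord e i : V -> K^o).

Lemma dual_basisE n (V : vectType K) (e : n.-tuple V) (i : 'I_n) v :
  dual_basis e i v = coord e i v.
Proof. by rewrite linfunE // => k a b; rewrite linearP. Qed.

Lemma dual_basis_delta n (V : vectType K) (e : n.-tuple V) (i j : 'I_n) :
  basis_of fullv e -> dual_basis e i e`_j = (i == j)%:R.
Proof.
by move=> e_basis; rewrite dual_basisE coord_free ?(basis_free e_basis) 1?eq_sym.
Qed.

End Dual.

(* V (x) W is modelled by the coordinate matrices of its elements in the      *)
(* bases vbasis {:V} and vbasis {:W}; tpure_linl, tpure_linr, tlift_pure and  *)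
(* tens_expand show that tpure is a universal bilinear map, with tlift f the  *)
(* linear map induced by a bilinear map f.                                    *)
Section Tensor.
Variable K : fieldType.
Implicit Types V W : vectType K.

Definition tens V W : vectType K := 'M[K]_(\dim {:V}, \dim {:W}).

Definition tpure V W (v : V) (w : W) : tens V W :=
  \matrix_(i, j) (coord (vbasis {:V}) i v * coord (vbasis {:W}) j w).

Definition tlift V W (U : vectType K) (f : V -> W -> U) (t : tens V W) : U :=
  \sum_i \sum_j (t : 'M[K]_(_, _)) i j *: f (vbasis {:V})`_i (vbasis {:W})`_j.

Lemma tpure_linl V W (w : W) : linear ((@tpure V W)^~ w).
Proof.
by move=> k u v; apply/matrixP => i j; rewrite !mxE linearP mulrDl mulrA.
Qed.

Lemma tpure_linr V W (v : V) : linear (@tpure V W v).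
Proof.
move=> k u w; apply/matrixP => i j.
by rewrite !mxE linearP mulrDr [in LHS]mulrCA.
Qed.

Lemma tpure_linear_l V W (T : vectType K) (f : T -> V) (w : W) :
  linear f -> linear (fun x => tpure (f x) w).
Proof. by move=> fl k x y; rewrite fl; apply: (tpure_linl (V := V)). Qed.

Lemma tpure_linear_r V W (T : vectType K) (v : V) (f : T -> W) :
  linear f -> linear (fun x => tpure v (f x)).
Proof. by move=> fl k x y; rewrite fl; apply: tpure_linr. Qed.

Lemma tlift_linear V W (U : vectType K) (f : V -> W -> U) : linear (tlift f).
Proof.
move=> k s t; rewrite /tlift scaler_sumr -big_split; apply: eq_bigr => i _ /=.
rewrite scaler_sumr -big_split; apply: eq_bigr => j _ /=.
by rewrite !mxE scalerDl scalerA.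
Qed.

Lemma tlift_pure V W (U : vectType K) (f : V -> W -> U) :
    (forall w, linear (f^~ w)) -> (forall v, linear (f v)) ->
  forall v w, tlift f (tpure v w) = f v w.
Proof.
move=> fl fr v w.
rewrite {2}[v](coord_vbasis (memvf v)) {2}[w](coord_vbasis (memvf w)).
under [LHS]eq_bigr => i _ do under eq_bigr => j _ do rewrite mxE.
rewrite -(bilfunE fl fr) [bilfun f _]linear_sum sum_lfunE.
apply: eq_bigr => i _.
rewrite linearZ scale_lfunE /= linear_sum scaler_sumr; apply: eq_bigr => j _.
by rewrite linearZ /= scalerA bilfunE.
Qed.

Lemma tlift_sum V W (U : vectType K) (f : V -> W -> U) m (a : 'I_m -> V)
    (b : 'I_m -> W) :
    (forall w, linear (f^~ w)) -> (forall v, linear (f v)) ->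
  tlift f (\sum_i tpure (a i) (b i)) = \sum_i f (a i) (b i).
Proof.
move=> fl fr; have fL := linfunE (@tlift_linear _ _ _ f).
by rewrite -fL linear_sum; apply: eq_bigr => i _; rewrite [LHS]fL tlift_pure.
Qed.

Lemma tlift_linear_fun V W (U T : vectType K) (f : T -> V -> W -> U) t :
  (forall v w, linear (fun u => f u v w)) -> linear (fun u => tlift (f u) t).
Proof.
move=> fl k u u'; rewrite /tlift scaler_sumr -big_split; apply: eq_bigr => i _ /=.
rewrite scaler_sumr -big_split; apply: eq_bigr => j _ /=.
by rewrite fl scalerDr !scalerA mulrC.
Qed.

Lemma tens_expand V W (t : tens V W) : t = tlift (@tpure V W) t.
Proof.
apply/matrixP => i j; rewrite /tlift summxE (bigD1 i) //= summxE.
have cE (X : vectType K) (k l : 'I_(\dim {:X})) :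
    coord (vbasis {:X}) k (vbasis {:X})`_l = (l == k)%:R.
  by rewrite coord_free ?(basis_free (vbasisP _)).
rewrite (bigD1 j) //= !mxE !cE !eqxx !mulr1 !big1 ?addr0 //.
  move=> i' i'i; rewrite summxE big1 // => j' _.
  by rewrite !mxE !cE (negbTE i'i) mul0r mulr0.
by move=> j' j'j; rewrite !mxE !cE (negbTE j'j) !mulr0.
Qed.

Definition tmap V W V' W' (f : 'Hom(V, V')) (g : 'Hom(W, W')) :
  tens V W -> tens V' W' := tlift (fun v w => tpure (f v) (g w)).

Definition tflip V W : tens V W -> tens W V := tlift (fun v w => tpure w v).

Definition tpair V W (t : tens V W) (x : vdual V) (y : vdual W) : K^o :=
  tlift (fun v w => (x v : K) * (y w : K) : K^o) t.

Lemma tmap_pure V W V' W' (f : 'Hom(V, V')) (g : 'Hom(W, W')) v w :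
  tmap f g (tpure v w) = tpure (f v) (g w).
Proof.
rewrite /tmap tlift_pure // => u k a b; first by rewrite linearP tpure_linl.
by rewrite linearP tpure_linr.
Qed.

Lemma tflip_pure V W (v : V) (w : W) : tflip (tpure v w) = tpure w v.
Proof.
by rewrite /tflip tlift_pure // => u k a b; rewrite (tpure_linl, tpure_linr).
Qed.

Lemma tpair_pure V W (v : V) (w : W) (x : vdual V) (y : vdual W) :
  tpair (tpure v w) x y = (x v : K) * (y w : K).
Proof.
rewrite /tpair tlift_pure // => u k a b; rewrite linearP /=.
  by rewrite mulrDl; congr (_ + _); rewrite -[LHS]mulrA.
by rewrite mulrDr; congr (_ + _); rewrite [LHS]mulrCA.
Qed.

Lemma tpair_linl V W (y : vdual W) (t : tens V W) :
  linear (fun x : vdual V => tpair t x y).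
Proof.
move=> k x x'; rewrite /tpair /tlift scaler_sumr -big_split.
apply: eq_bigr => i _ /=; rewrite scaler_sumr -big_split.
apply: eq_bigr => j _ /=; rewrite add_lfunE scale_lfunE.
rewrite mulrDl scalerDr; congr (_ + _).
by rewrite -[X in _ *: X]mulrA; apply: mulrCA.
Qed.

Lemma tpair_linr V W (x : vdual V) (t : tens V W) :
  linear (fun y : vdual W => tpair t x y).
Proof.
move=> k y y'; rewrite /tpair /tlift scaler_sumr -big_split.
apply: eq_bigr => i _ /=; rewrite scaler_sumr -big_split.
apply: eq_bigr => j _ /=; rewrite add_lfunE scale_lfunE.
rewrite mulrDr scalerDr; congr (_ + _).
by rewrite [X in _ *: X]mulrCA; apply: mulrCA.
Qed.

End Tensor.

Section Coproduct.
Variables (K : fieldType) (A : vectType K).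

(* The coproduct on A dual to a product on A^*                                *)
Definition coprod (m : 'Hom(vdual A, 'End(vdual A))) : 'Hom(A, tens A A) :=
  let d := dual_basis (vbasis {:A}) in
  linfun (fun a : A => (\matrix_(i, j) m (d i) (d j) a) : tens A A).

(* The product on A^* dual to a coproduct on A                                *)
Definition dual_prod (delta : 'Hom(A, tens A A)) :
    'Hom(vdual A, 'End(vdual A)) :=
  bilfun (fun x y : vdual A => linfun (fun a => tpair (delta a) x y) : vdual A).

Lemma dual_expand (x : vdual A) :
  x = \sum_(i < \dim {:A}) (x (vbasis {:A})`_i : K) *: dual_basis (vbasis {:A}) i.
Proof.
apply/lfunP => v; rewrite {1}[v](coord_vbasis (memvf v)) linear_sum sum_lfunE.
by apply: eq_bigr => i _; rewrite linearZ scale_lfunE dual_basisE; apply: mulrC.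
Qed.

Lemma coprodE m (a : A) (x y : vdual A) : tpair (coprod m a) x y = m x y a.
Proof.
rewrite /coprod linfunE; last first.
  by move=> k u v; apply/matrixP => i j; rewrite !mxE linearP.
rewrite {2}[x]dual_expand [m _]linear_sum !sum_lfunE; apply: eq_bigr => i _.
rewrite {2}[y]dual_expand linear_sum sum_lfunE.
apply: eq_bigr => j _; rewrite mxE ![in RHS](linearZ, scale_lfunE) /= scale_lfunE /= scale_lfunE.
rewrite [LHS]mulrC -[LHS]mulrA [LHS]mulrCA.
by [].
Qed.

Lemma dual_prodE delta (x y : vdual A) (a : A) :
  dual_prod delta x y a = tpair (delta a) x y.
Proof.
have lin u v : linear (fun a => tpair (delta a) u v).
  by move=> k b c; rewrite linearP; apply: tlift_linear.
rewrite /dual_prod bilfunE ?linfunE // => [u k v w|u k v w]; apply/lfunP => b;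
  by rewrite add_lfunE scale_lfunE !linfunE // (tpair_linl, tpair_linr).
Qed.

Lemma coprodK m : dual_prod (coprod m) = m.
Proof.
by apply/lfunP => x; apply/lfunP => y; apply/lfunP => a; rewrite dual_prodE coprodE.
Qed.

Lemma dual_prodK delta : coprod (dual_prod delta) = delta.
Proof.
apply/lfunP => a; rewrite /coprod linfunE; last first.
  by move=> k u v; apply/matrixP => i j; rewrite !mxE linearP.
apply/matrixP => i j; rewrite mxE dual_prodE.
rewrite [in RHS](tens_expand (delta a)) /tpair /tlift summxE.
apply: eq_bigr => k _; rewrite summxE; apply: eq_bigr => l _.
by rewrite !mxE !dual_basisE.
Qed.

End Coproduct.

Section PoissonAlgebra.
Variables (K : fieldType) (A : vectType K).
Implicit Types br mul : 'Hom(A, 'End(A)).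

Record lie_algebra br : Prop := LieAlgebra {
  lie_alt : forall a, br a a = 0;
  lie_jacobi : forall a b c, br a (br b c) + br b (br c a) + br c (br a b) = 0
}.

Record comm_algebra mul : Prop := CommAlgebra {
  comm_mulC : forall a b, mul a b = mul b a;
  comm_mulA : forall a b c, mul (mul a b) c = mul a (mul b c)
}.

Record poisson_algebra br mul : Prop := PoissonAlgebra {
  poisson_lie : lie_algebra br;
  poisson_comm : comm_algebra mul;
  poisson_leibniz : forall a b c,
    br a (mul b c) = mul (br a b) c + mul b (br a c)
}.

End PoissonAlgebra.

Section PoissonBialgebra.
Variables (K : fieldType) (A : vectType K).
Implicit Types br mul : 'Hom(A, 'End(A)).

Record poisson_bialgebra br mul (brD mulD : 'Hom(vdual A, 'End(vdual A))) :
    Prop := PoissonBialgebra {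
  bialg_poisson : poisson_algebra br mul;
  bialg_dual_poisson : poisson_algebra brD mulD;
  bialg_delta_br : let delta := coprod brD in forall a b,
    delta (br a b) =
      (tmap (br a) \1%VF (delta b) + tmap \1%VF (br a) (delta b))
      - (tmap (br b) \1%VF (delta a) + tmap \1%VF (br b) (delta a));
  bialg_Delta_mul : let Delta := coprod mulD in forall a b,
    Delta (mul a b) =
      tmap (mul a) \1%VF (Delta b) + tmap \1%VF (mul b) (Delta a);
  bialg_delta_mul : let delta := coprod brD in let Delta := coprod mulD in
    forall a b,
    delta (mul a b) =
      tmap (mul a) \1%VF (delta b) + tmap (mul b) \1%VF (delta a)
      + tmap \1%VF (br a) (Delta b) + tmap \1%VF (br b) (Delta a);
  bialg_Delta_br : let delta := coprod brD in let Delta := coprod mulD in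
    forall a b,
    Delta (br a b) =
      (tmap (br a) \1%VF (Delta b) + tmap \1%VF (br a) (Delta b))
      + (tmap (mul b) \1%VF (delta a) - tmap \1%VF (mul b) (delta a))
}.

(* The notation (A, [,], ., delta, Delta)                                     *)
Definition poisson_bialgebra_co br mul (delta Delta : 'Hom(A, tens A A)) :
    Prop :=
  poisson_bialgebra br mul (dual_prod delta) (dual_prod Delta).

End PoissonBialgebra.

Section LinearCombinators.
Variables (K : fieldType) (U V : lmodType K).

Lemma linear_add (f g : U -> V) :
  linear f -> linear g -> linear (fun u => f u + g u).
Proof. by move=> fl gl k u v; rewrite fl gl scalerDr addrACA. Qed.

Lemma linear_sub (f g : U -> V) :
  linear f -> linear g -> linear (fun u => f u - g u).
Proof. by move=> fl gl k u v; rewrite fl gl scalerBr opprD addrACA. Qed.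

Lemma linear_pair (W : lmodType K) (f : U -> V) (g : U -> W) :
  linear f -> linear g -> linear (fun u => (f u, g u) : V * W).
Proof. by move=> fl gl k u v; rewrite fl gl. Qed.

End LinearCombinators.

Section Double.
Variables (K : fieldType) (A : vectType K).
Variables (br mul : 'Hom(A, 'End(A))).
Variables (brD mulD : 'Hom(vdual A, 'End(vdual A))).

Definition double : vectType K := (A * vdual A)%type.

Definition double_br : 'Hom(double, 'End(double)) :=
  bilfun (fun u v : double =>
    (br u.1 v.1 - transpose_dual (brD u.2) v.1 + transpose_dual (brD v.2) u.1,
     brD u.2 v.2 - transpose (br u.1) v.2 + transpose (br v.1) u.2) : double).

Definition double_mul : 'Hom(double, 'End(double)) :=
  bilfun (fun u v : double =>
    (mul u.1 v.1 + transpose_dual (mulD u.2) v.1 + transpose_dual (mulD v.2) u.1,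
     mulD u.2 v.2 + transpose (mul u.1) v.2 + transpose (mul v.1) u.2) : double).

Lemma double_brE (a b : A) (x y : vdual A) :
  double_br (a, x) (b, y) =
    (br a b - transpose_dual (brD x) b + transpose_dual (brD y) a,
     brD x y - transpose (br a) y + transpose (br b) x).
Proof.
rewrite bilfunE // => [v|u]; apply: linear_pair;
  do ![apply: linear_sub | apply: linear_add] => k w w' /=;
  by rewrite !linearP /= ?(transpose_linear, transpose_dual_linear)
             ?add_lfunE ?scale_lfunE.
Qed.

Lemma double_mulE (a b : A) (x y : vdual A) :
  double_mul (a, x) (b, y) =
    (mul a b + transpose_dual (mulD x) b + transpose_dual (mulD y) a,
     mulD x y + transpose (mul a) y + transpose (mul b) x).
Proof.
rewrite bilfunE // => [v|u]; apply: linear_pair;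
  do ![apply: linear_sub | apply: linear_add] => k w w' /=;
  by rewrite !linearP /= ?(transpose_linear, transpose_dual_linear)
             ?add_lfunE ?scale_lfunE.
Qed.

End Double.

Section YangBaxter.
Variables (K : fieldType) (B : vectType K).
Variables (br mul : 'Hom(B, 'End(B))).
Implicit Types r s : tens B B.

Definition delta_of r : 'Hom(B, tens B B) :=
  linfun (fun u => tmap \1%VF (br u) r + tmap (br u) \1%VF r).

Definition Delta_of r : 'Hom(B, tens B B) :=
  linfun (fun u => tmap \1%VF (mul u) r - tmap (mul u) \1%VF r).

Definition C_term (a b a' b' : B) : tens B (tens B B) :=
  tpure (br a a') (tpure b b') + tpure a (tpure a' (br b b'))
  + tpure a (tpure (br b a') b').

Definition A_term (a b a' b' : B) : tens B (tens B B) :=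
  tpure (mul a a') (tpure b b') + tpure a (tpure a' (mul b b'))
  - tpure a (tpure (mul a' b) b').

(* C_term and A_term are linear in each argument, so tlift extends them from  *)
(* decompositions of r in a basis; C_ofE and A_ofE give the value on an       *)
(* arbitrary decomposition r = \sum_i a_i (x) b_i.                            *)
Definition C_of r : tens B (tens B B) :=
  tlift (fun a b => tlift (C_term a b) r) r.

Definition A_of r : tens B (tens B B) :=
  tlift (fun a b => tlift (A_term a b) r) r.

Lemma delta_ofE r u :
  delta_of r u = tmap \1%VF (br u) r + tmap (br u) \1%VF r.
Proof.
rewrite /delta_of linfunE //; apply: linear_add;
  apply: tlift_linear_fun => a b k v w; rewrite linearP add_lfunE scale_lfunE.
  exact: tpure_linr.
exact: (tpure_linl (V := B)).
Qed.

Lemma Delta_ofE r u :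
  Delta_of r u = tmap \1%VF (mul u) r - tmap (mul u) \1%VF r.
Proof.
rewrite /Delta_of linfunE //; apply: linear_sub;
  apply: tlift_linear_fun => a b k v w; rewrite linearP add_lfunE scale_lfunE.
  exact: tpure_linr.
exact: (tpure_linl (V := B)).
Qed.

Lemma C_term_linear (a b a' b' : B) :
  [/\ linear (fun x => C_term x b a' b'), linear (fun x => C_term a x a' b'),
      linear (fun x => C_term a b x b') & linear (fun x => C_term a b a' x)].
Proof.
have idl : linear (fun x : B => x) by [].
have ml v : linear (fun x => br x v).
  by move=> k x y; rewrite linearP add_lfunE scale_lfunE.
have mr v : linear (fun x => br v x) by move=> k x y; rewrite linearP.
split; (apply: linear_add; first apply: linear_add);
  do ?[exact: idl | exact: ml | exact: mr
      | apply: tpure_linear_l | apply: tpure_linear_r].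
Qed.

Lemma C_ofE m (a b : 'I_m -> B) :
  C_of (\sum_i tpure (a i) (b i)) =
    \sum_i \sum_j C_term (a i) (b i) (a j) (b j).
Proof.
rewrite /C_of tlift_sum => [|w|v].
- apply: eq_bigr => i _; rewrite tlift_sum // => u.
    by have [] := C_term_linear (a i) (b i) u u.
  by have [] := C_term_linear (a i) (b i) u u.
- by apply: tlift_linear_fun => u v; have [] := C_term_linear u w u v.
by apply: tlift_linear_fun => u w; have [] := C_term_linear v u u w.
Qed.

Lemma A_term_linear (a b a' b' : B) :
  [/\ linear (fun x => A_term x b a' b'), linear (fun x => A_term a x a' b'),
      linear (fun x => A_term a b x b') & linear (fun x => A_term a b a' x)].
Proof.
have idl : linear (fun x : B => x) by [].
have ml v : linear (fun x => mul x v).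
  by move=> k x y; rewrite linearP add_lfunE scale_lfunE.
have mr v : linear (fun x => mul v x) by move=> k x y; rewrite linearP.
split; (apply: linear_sub; first apply: linear_add);
  do ?[exact: idl | exact: ml | exact: mr
      | apply: tpure_linear_l | apply: tpure_linear_r].
Qed.

Lemma A_ofE m (a b : 'I_m -> B) :
  A_of (\sum_i tpure (a i) (b i)) =
    \sum_i \sum_j A_term (a i) (b i) (a j) (b j).
Proof.
rewrite /A_of tlift_sum => [|w|v].
- apply: eq_bigr => i _; rewrite tlift_sum // => u.
    by have [] := A_term_linear (a i) (b i) u u.
  by have [] := A_term_linear (a i) (b i) u u.
- by apply: tlift_linear_fun => u v; have [] := A_term_linear u w u v.
by apply: tlift_linear_fun => u w; have [] := A_term_linear v u u w.
Qed.

Definition pybe_solution r : Prop := C_of r = 0 /\ A_of r = 0.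

Definition adL_invariant s : Prop :=
  forall u : B, tmap (br u) \1%VF s + tmap \1%VF (br u) s = 0
             /\ tmap (mul u) \1%VF s - tmap \1%VF (mul u) s = 0.

Definition sym_part r : tens B B := 2%:R^-1 *: (r + tflip r).

Definition r_plus r : 'Hom(vdual B, B) :=
  linfun (fun x : vdual B => tlift (fun a b => (x a : K) *: b) r).

Definition r_minus r : 'Hom(vdual B, B) :=
  linfun (fun y : vdual B => - tlift (fun a b => (y b : K) *: a) r).

Lemma r_plusE r (x y : vdual B) : y (r_plus r x) = tpair r x y.
Proof.
rewrite /r_plus linfunE; last first.
  by apply: tlift_linear_fun => a b k u v; rewrite add_lfunE scale_lfunE scalerDl scalerA.
rewrite /tlift linear_sum; apply: eq_bigr => i _.
by rewrite linear_sum; apply: eq_bigr => j _; rewrite linearZ /= linearZ.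
Qed.

Lemma r_minusE r (x y : vdual B) : - x (r_minus r y) = tpair r x y.
Proof.
rewrite /r_minus linfunE; last first.
  move=> k u v; rewrite scalerN -opprD; congr (- _).
  move: k u v; apply: tlift_linear_fun => a b k u v.
  by rewrite add_lfunE scale_lfunE scalerDl scalerA.
rewrite linearN opprK /tlift linear_sum; apply: eq_bigr => i _.
rewrite linear_sum; apply: eq_bigr => j _; rewrite linearZ /= linearZ /=.
by congr (_ *: _); apply: mulrC.
Qed.

Definition I_map r : 'Hom(vdual B, B) := r_plus r - r_minus r.

Definition quasi_triangular r : Prop :=
  [/\ poisson_bialgebra_co br mul (delta_of r) (Delta_of r),
      pybe_solution r
    & adL_invariant (sym_part r)].

Definition factorizable r : Prop :=
  quasi_triangular r /\ bijective (I_map r).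

End YangBaxter.

(* \sum_i e_i (x) e_i^*, in the tensor square of the double                   *)
Definition canonical_r (K : fieldType) (A : vectType K) n (e : n.-tuple A) :
    tens (double A) (double A) :=
  \sum_(i < n) tpure ((e`_i, 0) : double A) ((0, dual_basis e i) : double A).

(* Main.v *)
From mathcomp Require Import all_boot all_order all_algebra ring.
Require Import Defs.

(* The pairing B((a, x), (b, y)) = y(a) + x(b) on the double is invariant for   *)
(* both products.  Hence, tested against B, the Jacobi, associativity and       *)
(* Leibniz identities of the double become 4-linear identities in terms such as *)
(* B([u, v], [w, t]) that are symmetric in (most of) their arguments; they hold *)
(* on A and on A^* by the axioms of these algebras, and with arguments of both  *)
(* kinds they are the compatibility conditions of the bialgebra.  For any r the *)
(* coproducts delta_r and Delta_r satisfy these conditions in a Poisson         *)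
(* algebra; for the canonical r, I_r is the inverse of the isomorphism defined  *)
(* by B, and it turns the products dual to delta_r and Delta_r into             *)
(* (-[,]_A, [,]_{A^*}) and (-._A, ._{A^*}) on A + A^*.  The Yang-Baxter         *)
(* equations and the invariance of the symmetric part follow by moving          *)
(* endomorphisms across the dual bases e_i, e_i^*.                              *)

Set Implicit Arguments.
Unset Strict Implicit.
Unset Printing Implicit Defensive.

Import GRing.Theory.
Local Open Scope ring_scope.

(** The pairing [dform] on the double is symmetric, nondegenerate and invariant ([dform_br],
    [dform_mul]). It therefore trades each axiom of the double for a scalar identity in four
    arguments: [double_jacobi_form], [double_assoc_form], [double_leibniz_form]. Arguments may be
    taken in A or in its dual. With all four on one side, isotropy kills every term; with three on
    one side, the identity is an axiom of A or of the dual algebra; with two on each side, it is one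
    of the four compatibility conditions. This yields [double_poisson].

    The vectors e_i together with their duals form a basis whose [dform]-dual basis is the same
    family with the two halves exchanged. Hence r plus its flip is the Casimir tensor of [dform].
    Invariance of the form gives invariance of the symmetric part ([sym_part_invariant]), and
    nondegeneracy makes I_r the inverse of u -> [dform] u ([dform_I_map]), which is factorizability.
    Moving transposes across dual bases gives the Yang-Baxter equations ([canonical_pybe]).

    The compatibility conditions for the coproducts of r are automatic
    ([coboundary_poisson_bialgebra]). The dual products are Poisson because I_r transports them to a
    direct sum of Poisson algebras ([canonical_dual_poisson]). *)

Section TensorMaps.
Variable K : fieldType.
Implicit Types U V W : vectType K.

(** * Additivity of pure tensors, tensor maps and pairings *)

Lemma tpureDl V W (u v : V) (w : W) : tpure (u + v) w = tpure u w + tpure v w.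
Proof. by have := tpure_linl w 1 u v; rewrite !scale1r. Qed.

Lemma tpureDr V W (w : V) (u v : W) : tpure w (u + v) = tpure w u + tpure w v.
Proof. by have := tpure_linr w 1 u v; rewrite !scale1r. Qed.

Lemma tpureNl V W (v : V) (w : W) : tpure (- v) w = - tpure v w.
Proof. by apply/matrixP => i j; rewrite !mxE linearN mulNr. Qed.

Lemma tpureNr V W (v : V) (w : W) : tpure v (- w) = - tpure v w.
Proof. by apply/matrixP => i j; rewrite !mxE linearN mulrN. Qed.

Lemma tpure0l V W (w : W) : tpure (0 : V) w = 0.
Proof. by apply/matrixP => i j; rewrite !mxE linear0 mul0r. Qed.

Lemma tmap_linear V W V' W' (f : 'Hom(V, V')) (g : 'Hom(W, W')) :
  linear (tmap f g).
Proof. exact: tlift_linear. Qed.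

Lemma tmapD V W V' W' (f : 'Hom(V, V')) (g : 'Hom(W, W')) s t :
  tmap f g (s + t) = tmap f g s + tmap f g t.
Proof. by have := tmap_linear f g 1 s t; rewrite !scale1r. Qed.

Lemma tmapZ V W V' W' (f : 'Hom(V, V')) (g : 'Hom(W, W')) k t :
  tmap f g (k *: t) = k *: tmap f g t.
Proof.
have f0 : tmap f g 0 = 0.
  by have := tmap_linear f g (-1) 0 0; rewrite !scaleN1r oppr0 addr0 addNr.
by have := tmap_linear f g k t 0; rewrite f0 !addr0.
Qed.

Lemma tmapN V W V' W' (f : 'Hom(V, V')) (g : 'Hom(W, W')) t :
  tmap f g (- t) = - tmap f g t.
Proof. by rewrite -scaleN1r tmapZ scaleN1r. Qed.

Lemma tmap_sum V W V' W' (f : 'Hom(V, V')) (g : 'Hom(W, W')) (I : finType)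
    (a : I -> V) (b : I -> W) :
  tmap f g (\sum_i tpure (a i) (b i)) = \sum_i tpure (f (a i)) (g (b i)).
Proof.
have fL := linfunE (tmap_linear f g).
by rewrite -fL linear_sum; apply: eq_bigr => i _; rewrite /= fL tmap_pure.
Qed.

Lemma tpair_linear V W (x : vdual V) (y : vdual W) :
  linear (fun t : tens V W => tpair t x y).
Proof. exact: tlift_linear. Qed.

Lemma tpairD V W (x : vdual V) (y : vdual W) (s t : tens V W) :
  tpair (s + t) x y = tpair s x y + tpair t x y.
Proof. by have := tpair_linear x y 1 s t; rewrite !scale1r. Qed.

Lemma tpairN V W (x : vdual V) (y : vdual W) (t : tens V W) :
  tpair (- t) x y = - tpair t x y.
Proof.
have f0 : tpair (0 : tens V W) x y = 0.
  by have := tpair_linear x y (-1) 0 0; rewrite !scaleN1r oppr0 addr0 addNr.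
by have := tpair_linear x y (-1) t 0; rewrite f0 !scaleN1r !addr0.
Qed.

Lemma tpair_sum V W (x : vdual V) (y : vdual W) m (a : 'I_m -> V)
    (b : 'I_m -> W) :
  tpair (\sum_i tpure (a i) (b i)) x y = \sum_i (x (a i) : K) * (y (b i) : K).
Proof.
have fL := linfunE (tpair_linear x y).
by rewrite -fL linear_sum; apply: eq_bigr => i _; rewrite /= fL tpair_pure.
Qed.

Lemma tpair_tmap V W V' W' (f : 'Hom(V, V')) (g : 'Hom(W, W')) t x y :
  tpair (tmap f g t) x y = tpair t (transpose f x) (transpose g y).
Proof.
have fL := linfunE (tpair_linear x y).
rewrite -fL /tmap /tlift linear_sum; apply: eq_bigr => i _ /=.
rewrite linear_sum; apply: eq_bigr => j _ /=.
by rewrite linearZ /= fL tpair_pure !transposeE.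
Qed.

Lemma transpose1 V (x : vdual V) : transpose \1%VF x = x.
Proof. by apply/lfunP => v; rewrite transposeE id_lfunE. Qed.

Lemma transpose0 V W : transpose (0 : 'Hom(V, W)) = 0.
Proof.
by apply/lfunP => x; apply/lfunP => v; rewrite transposeE !zero_lfunE linear0.
Qed.

Lemma bilinDl U V W (m : 'Hom(U, 'Hom(V, W))) v a b : m (a + b) v = m a v + m b v.
Proof. by rewrite linearD add_lfunE. Qed.

Lemma bilinNl U V W (m : 'Hom(U, 'Hom(V, W))) v a : m (- a) v = - m a v.
Proof. by rewrite linearN opp_lfunE. Qed.

End TensorMaps.

(** * Coboundary coproducts in a Poisson algebra *)

Section Coboundary.
Variables (K : fieldType) (B : vectType K) (br mul : 'Hom(B, 'End(B))).
Hypothesis PB : poisson_algebra br mul.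

Lemma lie_anti a b : br a b = - br b a.
Proof.
have [[alt _] _ _] := PB; apply/eqP; rewrite -addr_eq0; apply/eqP.
have := alt (a + b).
by rewrite bilinDl !linearD /= !alt addr0 add0r.
Qed.

Lemma lie_ad a b c : br a (br b c) = br (br a b) c + br b (br a c).
Proof.
have [[alt jac] _ _] := PB; have /eqP := jac a b c.
rewrite (lie_anti c a) (lie_anti c (br a b)) linearN /= subr_eq add0r.
by rewrite subr_eq => /eqP.
Qed.

Lemma comm_mulCA a b c : mul b (mul a c) = mul (mul a b) c.
Proof.
by have [_ [mC mA] _] := PB; rewrite -mA (mC b a).
Qed.

Lemma poisson_leibnizl a b c : br (mul a b) c = mul a (br b c) + mul b (br a c).
Proof.
have [_ [mC _] lei] := PB.
rewrite lie_anti lei opprD (mC (br c a)) (lie_anti c a) (lie_anti c b).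
by rewrite !linearN !opprK addrC.
Qed.

Section Tensor.
Variables (m : nat) (p q : 'I_m -> B).
Let r := \sum_i tpure (p i) (q i).

(** The four compatibility conditions are linear in r, so they are checked on each pure tensor,
    entry by entry in coordinates. There they follow from the fact that ad(a) is a derivation of
    both products and from associativity. *)
Lemma coboundary_poisson_bialgebra :
    poisson_algebra (dual_prod (delta_of br r)) (dual_prod (Delta_of mul r)) ->
  poisson_bialgebra_co br mul (delta_of br r) (Delta_of mul r).
Proof.
have [_ [mC mA] lei] := PB => dual_poisson.
split=> //=; rewrite !dual_prodK => a b; rewrite !(delta_ofE, Delta_ofE);
  rewrite !(tmapD, tmapN, tmap_sum) -?sumrN -!big_split -?sumrN -?big_split;
  apply: eq_bigr => i _; apply/matrixP => j k; rewrite !id_lfunE !mxE.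
- by rewrite !(lie_ad a b) !linearD /=; ring.
- by rewrite !(comm_mulCA a b) -!(mA a b); ring.
- rewrite !poisson_leibnizl !lei !(lie_anti b a) !bilinNl.
  by rewrite !linearD !linearN /=; ring.
by rewrite !lei !linearD /=; ring.
Qed.

End Tensor.
End Coboundary.

(** * Evaluation of dual vectors *)

Section DualPairing.
Variables (K : fieldType) (A : vectType K).

(** The value is typed in the field [K] rather than in the module [K^o], so that identities between
    evaluations are plain ring identities. *)
Definition ev (x : vdual A) (a : A) : K := x a.

Lemma evDl x y a : ev (x + y) a = ev x a + ev y a.
Proof. by rewrite /ev add_lfunE. Qed.

Lemma evDr x a b : ev x (a + b) = ev x a + ev x b.
Proof. by rewrite /ev linearD. Qed.

Lemma evNl x a : ev (- x) a = - ev x a.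
Proof. by rewrite /ev opp_lfunE. Qed.

Lemma evNr x a : ev x (- a) = - ev x a.
Proof. by rewrite /ev linearN. Qed.

Lemma ev0l a : ev 0 a = 0.
Proof. by rewrite /ev zero_lfunE. Qed.

Lemma ev0r x : ev x 0 = 0.
Proof. by rewrite /ev linear0. Qed.

Lemma ev_sep a b : (forall x, ev x a = ev x b) -> a = b.
Proof.
move=> xab; apply/eqP; rewrite -subr_eq0 -memv0 -(lker_bidual A) memv_ker.
apply/eqP/lfunP => x; rewrite linearB /= add_lfunE opp_lfunE !bidualE zero_lfunE.
by have := xab x; rewrite /ev => ->; rewrite subrr.
Qed.

Lemma ev_transpose f x a : ev (transpose f x) a = ev x (f a).
Proof. exact: transposeE. Qed.

Lemma ev_transpose_dual f x a : ev x (transpose_dual f a) = ev (f x) a.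
Proof. exact: transpose_dualE. Qed.

Lemma transpose_dual0 : transpose_dual (0 : 'End(vdual A)) = 0.
Proof.
apply/lfunP => v; apply: ev_sep => x.
by rewrite ev_transpose_dual !zero_lfunE ev0l ev0r.
Qed.

End DualPairing.

(** * The canonical symmetric form on the double *)

Section DoubleForm.
Variables (K : fieldType) (A : vectType K).
Implicit Types u v w t : double A.

Definition dform u v : K := ev v.2 u.1 + ev u.2 v.1.

Lemma dformC u v : dform u v = dform v u.
Proof. by rewrite /dform addrC. Qed.

Lemma dformDl u v w : dform (u + v) w = dform u w + dform v w.
Proof. by rewrite /dform /= evDl evDr addrACA. Qed.

Lemma dformDr u v w : dform u (v + w) = dform u v + dform u w.
Proof. by rewrite dformC dformDl !(dformC u). Qed.

Lemma dformNl u v : dform (- u) v = - dform u v.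
Proof. by rewrite /dform /= evNl evNr -opprD. Qed.

Lemma dform0l u : dform 0 u = 0.
Proof. by rewrite /dform /= ev0l ev0r addr0. Qed.

Lemma dformNr u v : dform u (- v) = - dform u v.
Proof. by rewrite dformC dformNl dformC. Qed.

Lemma dform_sep u v : (forall w, dform u w = dform v w) -> u = v.
Proof.
case: u v => [a x] [b y] uv; congr pair.
  by apply: ev_sep => z; have := uv (0, z); rewrite /dform /= !ev0r !addr0.
by apply/lfunP => c; have := uv (c, 0); rewrite /dform /= !ev0l !add0r.
Qed.

Lemma double_split u : u = (u.1, 0) + (0, u.2).
Proof. by case: u => a x; congr pair; rewrite /= ?addr0 ?add0r. Qed.

(* A permutation-invariant additive property of several elements of the double
   has to be checked only up to the number of arguments taken in A^*. *)
Lemma double_ind3 (Z : double A -> double A -> double A -> Prop) :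
    (forall u u' v w, Z u v w -> Z u' v w -> Z (u + u') v w) ->
    (forall u v w, Z u v w -> Z v u w) -> (forall u v w, Z u v w -> Z u w v) ->
    (forall a b c, Z (a, 0) (b, 0) (c, 0)) ->
    (forall a b z, Z (a, 0) (b, 0) (0, z)) ->
    (forall a y z, Z (a, 0) (0, y) (0, z)) ->
    (forall x y z, Z (0, x) (0, y) (0, z)) ->
  forall u v w, Z u v w.
Proof.
move=> ZD Z12 Z23 h0 h1 h2 h3 u v w.
have ZD2 u1 v1 v2 w1 : Z u1 v1 w1 -> Z u1 v2 w1 -> Z u1 (v1 + v2) w1.
  by move=> z1 z2; apply/Z12/ZD; apply/Z12.
have ZD3 u1 v1 w1 w2 : Z u1 v1 w1 -> Z u1 v1 w2 -> Z u1 v1 (w1 + w2).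
  by move=> z1 z2; apply/Z23/ZD2; apply/Z23.
rewrite (double_split u) (double_split v) (double_split w).
by apply/ZD; apply/ZD2; apply/ZD3; auto 6.
Qed.

Lemma double_ind4 (Z : double A -> double A -> double A -> double A -> Prop) :
    (forall u u' v w t, Z u v w t -> Z u' v w t -> Z (u + u') v w t) ->
    (forall u v w t, Z u v w t -> Z v u w t) ->
    (forall u v w t, Z u v w t -> Z u w v t) ->
    (forall u v w t, Z u v w t -> Z u v t w) ->
    (forall a b c d, Z (a, 0) (b, 0) (c, 0) (d, 0)) ->
    (forall a b c z, Z (a, 0) (b, 0) (c, 0) (0, z)) ->
    (forall a b y z, Z (a, 0) (b, 0) (0, y) (0, z)) ->
    (forall a x y z, Z (a, 0) (0, x) (0, y) (0, z)) ->
    (forall x y z z', Z (0, x) (0, y) (0, z) (0, z')) ->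
  forall u v w t, Z u v w t.
Proof.
move=> ZD Z12 Z23 Z34 h0 h1 h2 h3 h4 u v w t.
rewrite (double_split u); apply/ZD.
  by apply: (double_ind3 (Z := Z (u.1, 0))) => *; auto; apply/Z12/ZD; apply/Z12.
by apply: (double_ind3 (Z := Z (0, u.2))) => *; auto 6; apply/Z12/ZD; apply/Z12.
Qed.

End DoubleForm.

(** * The double is a Poisson algebra *)

Section DoublePoisson.
Variables (K : fieldType) (A : vectType K).
Variables (br mul : 'Hom(A, 'End(A))).
Variables (brD mulD : 'Hom(vdual A, 'End(vdual A))).
Hypothesis bialgA : poisson_bialgebra br mul brD mulD.

Let dbr := double_br br brD.
Let dmul := double_mul mul mulD.
Let PA : poisson_algebra br mul := bialg_poisson bialgA.
Let PD : poisson_algebra brD mulD := bialg_dual_poisson bialgA.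

(** This and the next three facts are the compatibility conditions tested against x and y: tensor
    maps turn into transposes and coproducts into products on the dual, so that no tensor
    remains. *)
Let delta_br_ev a b x y : ev (brD x y) (br a b) =
  ev (brD (transpose (br a) x) y) b + ev (brD x (transpose (br a) y)) b
  - (ev (brD (transpose (br b) x) y) a + ev (brD x (transpose (br b) y)) a).
Proof.
have := congr1 (fun t => tpair t x y) (bialg_delta_br bialgA a b).
by rewrite /= !(tpairD, tpairN) !tpair_tmap !transpose1 !coprodE.
Qed.

Let Delta_mul_ev a b x y : ev (mulD x y) (mul a b) =
  ev (mulD (transpose (mul a) x) y) b + ev (mulD x (transpose (mul b) y)) a.
Proof.
have := congr1 (fun t => tpair t x y) (bialg_Delta_mul bialgA a b).
by rewrite /= !(tpairD, tpairN) !tpair_tmap !transpose1 !coprodE.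
Qed.

Let delta_mul_ev a b x y : ev (brD x y) (mul a b) =
  ev (brD (transpose (mul a) x) y) b + ev (brD (transpose (mul b) x) y) a
  + ev (mulD x (transpose (br a) y)) b + ev (mulD x (transpose (br b) y)) a.
Proof.
have := congr1 (fun t => tpair t x y) (bialg_delta_mul bialgA a b).
by rewrite /= !(tpairD, tpairN) !tpair_tmap !transpose1 !coprodE.
Qed.

Let Delta_br_ev a b x y : ev (mulD x y) (br a b) =
  (ev (mulD (transpose (br a) x) y) b + ev (mulD x (transpose (br a) y)) b)
  + (ev (brD (transpose (mul b) x) y) a - ev (brD x (transpose (mul b) y)) a).
Proof.
have := congr1 (fun t => tpair t x y) (bialg_Delta_br bialgA a b).
by rewrite /= !(tpairD, tpairN) !tpair_tmap !transpose1 !coprodE.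
Qed.

Let brC := lie_anti PA.
Let brDC := lie_anti PD.
Let mulC := comm_mulC (poisson_comm PA).
Let mulDC := comm_mulC (poisson_comm PD).

Lemma double_br_pure :
  ((forall a b, dbr (a, 0) (b, 0) = (br a b, 0)) *
   (forall a y, dbr (a, 0) (0, y) =
      (transpose_dual (brD y) a, - transpose (br a) y)) *
   (forall x b, dbr (0, x) (b, 0) =
      (- transpose_dual (brD x) b, transpose (br b) x)) *
   (forall x y, dbr (0, x) (0, y) = (0, brD x y)))%type.
Proof.
split; first split; first split; move=> u v; rewrite /dbr double_brE;
  by rewrite !(linear0, zero_lfunE, transpose0, transpose_dual0, addr0, oppr0, add0r).
Qed.

Lemma double_mul_pure :
  ((forall a b, dmul (a, 0) (b, 0) = (mul a b, 0)) *
   (forall a y, dmul (a, 0) (0, y) =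
      (transpose_dual (mulD y) a, transpose (mul a) y)) *
   (forall x b, dmul (0, x) (b, 0) =
      (transpose_dual (mulD x) b, transpose (mul b) x)) *
   (forall x y, dmul (0, x) (0, y) = (0, mulD x y)))%type.
Proof.
split; first split; first split; move=> u v; rewrite /dmul double_mulE;
  by rewrite !(linear0, zero_lfunE, transpose0, transpose_dual0, addr0, oppr0, add0r).
Qed.

Let evE := (evDl, evDr, evNl, evNr, ev0l, ev0r).
Let trE := (ev_transpose_dual, ev_transpose).

Lemma double_br_alt u : dbr u u = 0.
Proof.
case: u => a x; rewrite /dbr double_brE.
by rewrite (lie_alt (poisson_lie PA)) (lie_alt (poisson_lie PD)) !sub0r !addNr.
Qed.

Lemma double_brC u v : dbr u v = - dbr v u.
Proof.
apply/eqP; rewrite -addr_eq0; apply/eqP.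
have := double_br_alt (u + v).
by rewrite bilinDl !linearD /= !double_br_alt addr0 add0r.
Qed.

Lemma double_mulC u v : dmul u v = dmul v u.
Proof.
case: u v => [a x] [b y]; rewrite /dmul !double_mulE mulC mulDC.
by congr pair; rewrite -!addrA; congr (_ + _); rewrite addrC.
Qed.

Lemma dform_br u v w : dform (dbr u v) w = dform u (dbr v w).
Proof.
case: u v w => [a x] [b y] [c z]; rewrite /dbr !double_brE /dform /= !evE !trE.
by rewrite (brC b a) (brC c a) (brDC y x) (brDC z x) !evE; ring.
Qed.

Lemma dform_mul u v w : dform (dmul u v) w = dform u (dmul v w).
Proof.
case: u v w => [a x] [b y] [c z]; rewrite /dmul !double_mulE /dform /= !evE !trE.
by rewrite (mulC b a) (mulC c a) (mulDC y x) (mulDC z x); ring.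
Qed.

(* The left side is, up to sign, the Jacobiator of u, v, w paired with t. *)
Lemma double_jacobi_form u v w t :
  dform (dbr v w) (dbr u t) + dform (dbr w u) (dbr v t)
    + dform (dbr u v) (dbr w t) = 0.
Proof.
have jac := lie_jacobi (poisson_lie PA); have jacD := lie_jacobi (poisson_lie PD).
move: u v w t; apply: double_ind4.
- move=> u u' v w t h h'; rewrite !(bilinDl, linearD, dformDl, dformDr) /=.
  by rewrite -[RHS]addr0 -{1}h -h'; ring.
- move=> u v w t h; rewrite (double_brC u w) (double_brC w v) (double_brC v u).
  by rewrite !dformNl -[RHS]oppr0 -h; ring.
- move=> u v w t h; rewrite (double_brC u w) (double_brC w v) (double_brC v u).
  by rewrite !dformNl -[RHS]oppr0 -h; ring.
- move=> u v w t h.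
  rewrite (double_brC t u) (double_brC t w) (dformC _ (dbr u w)).
  rewrite (double_brC u w) (dformC _ (dbr v w)) !(dformNl, dformNr).
  by rewrite -[RHS]oppr0 -h; ring.
(* A is closed under the bracket and isotropic for [dform]. *)
- by move=> a b c d; rewrite !double_br_pure /dform /= !evE !addr0.
(* Three arguments in A: minus the Jacobi sum of A, evaluated by z. *)
- move=> a b c z; rewrite !double_br_pure /dform /= !evE !trE.
  by rewrite -[RHS]oppr0 -[in RHS](ev0r z) -(jac a b c) !evE; ring.
(* Two arguments on each side: the cocycle condition on delta. *)
- move=> a b y z; rewrite !double_br_pure /dform /= !evE !trE delta_br_ev.
  by rewrite (brDC _ z) (brDC (transpose (br b) y) z) !evE; ring.
- move=> a x y z; rewrite !double_br_pure /dform /= !evE !trE.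
  by rewrite -[RHS](ev0l a) -(jacD x y z) (brDC z x) linearN /= !evE; ring.
by move=> x y z z'; rewrite !double_br_pure /dform /= !evE !addr0.
Qed.

(** By invariance and commutativity, associativity says that [dform] of two products does not depend
    on how the four factors are paired off. *)
Lemma double_assoc_form u v w t :
  dform (dmul u v) (dmul w t) = dform (dmul u w) (dmul v t).
Proof.
have mA := comm_mulA (poisson_comm PA); have mDA := comm_mulA (poisson_comm PD).
(* One equality alone is not stable under permuting the arguments, as [double_ind4] requires;
   equality of all three pairings is. *)
suff [] : dform (dmul u v) (dmul w t) = dform (dmul u w) (dmul v t) /\
          dform (dmul u v) (dmul w t) = dform (dmul u t) (dmul v w) by [].
move: u v w t; apply: double_ind4.
- move=> u u' v w t [h1 h2] [h1' h2']; rewrite !(bilinDl, dformDl).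
  by rewrite -h1 -h2 -h1' -h2'.
- move=> u v w t [h1 h2]; rewrite (double_mulC v u) (dformC (dmul v w)) -h2.
  by rewrite (dformC (dmul v t)) -h1.
- by move=> u v w t [h1 h2]; rewrite -h1 h2 (double_mulC w v).
- by move=> u v w t [h1 h2]; rewrite (double_mulC t w) -h2 h1.
- by move=> a b c d; rewrite !double_mul_pure /dform /= !evE !addr0.
- move=> a b c z; rewrite !double_mul_pure /dform /= !evE !trE !addr0 !add0r.
  by rewrite (mulC c) (mulC b (mul a c)) !mA (mulC c b).
(* Two arguments on each side: the condition on Delta of a product. *)
- move=> a b y z; rewrite !double_mul_pure /dform /= !evE !trE !addr0.
  split; last rewrite mulC; rewrite Delta_mul_ev (mulDC (transpose _ y) z); ring.
- move=> a x y z; rewrite !double_mul_pure /dform /= !evE !trE !addr0.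
  by rewrite -!mDA (mulDC y x) (mulDC z) !mDA (mulDC y z).
by move=> x y z z'; rewrite !double_mul_pure /dform /= !evE !addr0.
Qed.

(** Moving ad(u) and the multiplications across [dform] turns the Leibniz rule, paired with t, into
    this sum. *)
Lemma double_leibniz_form u v w t :
  dform (dmul v w) (dbr u t) + dform (dmul w t) (dbr u v)
    + dform (dmul v t) (dbr u w) = 0.
Proof.
have lei := poisson_leibniz PA; have leiD := poisson_leibniz PD.
have uD u1 u2 : dform (dmul v w) (dbr u1 t) + dform (dmul w t) (dbr u1 v)
    + dform (dmul v t) (dbr u1 w) = 0 ->
    dform (dmul v w) (dbr u2 t) + dform (dmul w t) (dbr u2 v)
    + dform (dmul v t) (dbr u2 w) = 0 ->
    dform (dmul v w) (dbr (u1 + u2) t) + dform (dmul w t) (dbr (u1 + u2) v)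
    + dform (dmul v t) (dbr (u1 + u2) w) = 0.
  move=> h h'; rewrite !(bilinDl, dformDr) /=.
  by rewrite -[RHS]addr0 -{1}h -h'; ring.
(* The sum is symmetric in v, w, t only, so u is split separately and [double_ind3] is used once for
   each of its parts. *)
rewrite (double_split u); apply: uD.
  move: v w t; apply: double_ind3.
  - move=> v v' w t h h'; rewrite !(bilinDl, linearD, dformDl, dformDr) /=.
    by rewrite -[RHS]addr0 -{1}h -h'; ring.
  - by move=> v w t h; rewrite (double_mulC w v) -h; ring.
  - by move=> v w t h; rewrite (double_mulC t w) -h; ring.
  - by move=> b c d; rewrite !double_mul_pure !double_br_pure /dform /= !evE !addr0.
  - move=> b c z; rewrite !double_mul_pure !double_br_pure /dform /= !evE !trE lei.
    by rewrite (mulC (br u.1 b)) evE; ring.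
  (* With u in A, the balanced case is the condition on Delta of a bracket. *)
  - move=> b y z; rewrite !double_mul_pure !double_br_pure /dform /= !evE !trE Delta_br_ev.
    rewrite (mulDC (transpose (br _) y) z) (brDC (transpose (mul _) y) z) !evE; ring.
  move=> x y z; rewrite !double_mul_pure !double_br_pure /dform /= !evE !trE !leiD.
  rewrite (brDC z x) (brDC z y) (brDC y x) (mulDC y (brD x z)).
  by rewrite !(bilinNl, linearN) /= !evE; ring.
move: v w t; apply: double_ind3.
- move=> v v' w t h h'; rewrite !(bilinDl, linearD, dformDl, dformDr) /=.
  by rewrite -[RHS]addr0 -{1}h -h'; ring.
- by move=> v w t h; rewrite (double_mulC w v) -h; ring.
- by move=> v w t h; rewrite (double_mulC t w) -h; ring.
- move=> b c d; rewrite !double_mul_pure !double_br_pure /dform /= !evE !trE !lei.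
  rewrite (brC d b) (brC d c) (brC c b) (mulC c (br b d)).
  by rewrite !(bilinNl, linearN) /= !evE; ring.
(* With u in the dual, the balanced case is the condition on delta of a product. *)
- move=> b c z; rewrite !double_mul_pure !double_br_pure /dform /= !evE !trE.
  by rewrite !(brDC u.2) !evE delta_mul_ev; ring.
- move=> b y z; rewrite !double_mul_pure !double_br_pure /dform /= !evE !trE leiD.
  by rewrite (mulDC (brD u.2 y)) evE; ring.
by move=> x y z; rewrite !double_mul_pure !double_br_pure /dform /= !evE !addr0.
Qed.

Lemma double_poisson : poisson_algebra dbr dmul.
Proof.
split; first split.
- exact: double_br_alt.
- move=> u v w; apply: dform_sep => t; rewrite !dformDl dform0l.
  rewrite !(double_brC _ (dbr _ _)) !dformNl !(dform_br (dbr _ _)).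
  by rewrite -[RHS]oppr0 -(double_jacobi_form u v w t); ring.
- split; first exact: double_mulC.
  move=> u v w; apply: dform_sep => t.
  rewrite (double_mulC u (dmul v w)) !(dform_mul (dmul _ _)).
  by rewrite (double_assoc_form v w u) (double_mulC v u).
move=> u v w; apply: dform_sep => t; rewrite dformDl.
rewrite (double_brC u) dformNl dform_br (double_mulC v (dbr u w)) !(dform_mul (dbr _ _)).
rewrite (dformC (dbr u v)) (dformC (dbr u w)) -[RHS]subr0.
by rewrite -(double_leibniz_form u v w t); ring.
Qed.

End DoublePoisson.

(** Expanding phi(f_i) and psi(g_i) in the dual bases gives the same double sum, with coefficients
    beta(f_i, psi(g_k)), up to exchanging the two indices. *)
Lemma dual_bases_adjoint (K : fieldType) (V W U : vectType K) (I : finType)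
    (f : I -> V) (g : I -> W) (beta : V -> W -> K) (F : V -> W -> U)
    (phi : V -> V) (psi : W -> W) :
    (forall v, v = \sum_i beta v (g i) *: f i) ->
    (forall w, w = \sum_i beta (f i) w *: g i) ->
    (forall w, linear (F^~ w)) -> (forall v, linear (F v)) ->
    (forall v w, beta (phi v) w = beta v (psi w)) ->
  \sum_i F (phi (f i)) (g i) = \sum_i F (f i) (psi (g i)).
Proof.
move=> fE gE Fl Fr adj.
have FL i : F (phi (f i)) (g i) = \sum_k beta (f i) (psi (g k)) *: F (f k) (g i).
  rewrite [phi _ in LHS]fE -(bilfunE Fl Fr) linear_sum sum_lfunE.
  apply: eq_bigr => k _.
  by rewrite linearZ scale_lfunE /= (bilfunE Fl Fr) adj.
have FR i : F (f i) (psi (g i)) = \sum_k beta (f k) (psi (g i)) *: F (f i) (g k).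
  rewrite [psi _ in LHS]gE -(bilfunE Fl Fr) linear_sum.
  apply: eq_bigr => k _.
  by rewrite linearZ /= (bilfunE Fl Fr).
by rewrite (eq_bigr _ (fun i _ => FL i)) exchange_big; apply: eq_bigr => i _; rewrite FR.
Qed.

(** * The canonical tensor, its map I_r and its symmetric part *)

Section CanonicalTensor.
Variables (K : fieldType) (A : vectType K) (n : nat) (e : n.-tuple A).
Hypothesis e_basis : basis_of fullv e.

Let r := canonical_r e.
Let es := dual_basis e.

Lemma basis_expand (a : A) : a = \sum_(i < n) ev (es i) a *: e`_i.
Proof.
have ea : a \in <<e>>%VS by rewrite (span_basis e_basis) memvf.
by rewrite [LHS](coord_span ea); apply: eq_bigr => i _; rewrite /ev dual_basisE.
Qed.

Lemma dual_basis_expand (x : vdual A) : x = \sum_(i < n) ev x e`_i *: es i.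
Proof.
apply/lfunP => a; rewrite {1}[a]basis_expand linear_sum sum_lfunE.
apply: eq_bigr => i _; rewrite linearZ scale_lfunE /=; apply: mulrC.
Qed.

Lemma dual_basis_sum (phi : vdual A -> K^o) x :
  linear phi -> \sum_(i < n) ev x e`_i * (phi (es i) : K) = phi x.
Proof.
move=> phi_lin; have phiE := linfunE phi_lin.
rewrite {2}[x]dual_basis_expand -phiE linear_sum; apply: eq_bigr => i _.
by rewrite linearZ /= phiE.
Qed.

Lemma basis_sum (phi : A -> K^o) a :
  linear phi -> \sum_(i < n) (phi e`_i : K) * ev (es i) a = phi a.
Proof.
move=> phi_lin; have phiE := linfunE phi_lin.
rewrite {2}[a]basis_expand -phiE linear_sum; apply: eq_bigr => i _.
by rewrite linearZ /= phiE mulrC.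
Qed.

Definition dfun (u : double A) : vdual (double A) :=
  linfun (fun v : double A => dform u v : K^o).

Lemma dform_linear (u : double A) : linear (fun v : double A => dform u v : K^o).
Proof.
move=> k v w; rewrite dformDr; congr (_ + _).
rewrite /dform /ev /= linearZ scale_lfunE /= [RHS]mulrDr.
by [].
Qed.

Lemma dfunE u v : dfun u v = dform u v.
Proof. by rewrite linfunE //; apply: dform_linear. Qed.

(** I_r f is the sum of f(e_i) times the dual vector of e_i and of f on that dual vector times e_i,
    so pairing with u recovers the expansion of f(u). *)
Lemma dform_I_map u f : dform u (I_map r f) = f u.
Proof.
rewrite /I_map add_lfunE opp_lfunE dformDr dformNr -!dfunE r_plusE.
rewrite -[X in _ + X]/(- dfun u (r_minus r f)) r_minusE !tpair_sum.
have lin_l : linear (fun a : A => f (a, 0) : K^o).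
  by move=> k a b; rewrite -linearP; congr (f _); congr pair; rewrite /= scaler0 addr0.
have lin_r : linear (fun x : vdual A => f (0, x) : K^o).
  by move=> k a b; rewrite -linearP; congr (f _); congr pair; rewrite /= scaler0 addr0.
rewrite [in RHS](double_split u) linearD /= -(basis_sum _ lin_l) -(dual_basis_sum _ lin_r).
by congr (_ + _); apply: eq_bigr => i _;
  rewrite dfunE /dform /= ?ev0l ?ev0r ?addr0 ?add0r.
Qed.

Lemma I_map_dfun u : I_map r (dfun u) = u.
Proof.
by apply: dform_sep => v; rewrite dformC dform_I_map dfunE.
Qed.

Lemma dfun_I_map f : dfun (I_map r f) = f.
Proof. by apply/lfunP => v; rewrite dfunE dformC dform_I_map. Qed.

Lemma I_map_bij : bijective (I_map r).
Proof. exact: Bijective dfun_I_map I_map_dfun. Qed.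

(** [fd] and [gd] are bases of the double dual to each other under [dform]; exchanging the two
    halves makes the pairing diagonal. *)
Let fd (s : 'I_n + 'I_n) : double A :=
  match s with inl i => (e`_i, 0) | inr i => (0, es i) end.
Let gd (s : 'I_n + 'I_n) : double A :=
  match s with inl i => (0, es i) | inr i => (e`_i, 0) end.

Lemma double_expand_f u : u = \sum_s dform u (gd s) *: fd s.
Proof.
rewrite big_sumType /= [LHS]double_split; congr (_ + _).
  have lin : linear (fun a : A => (a, 0) : double A).
    by move=> k a b; congr pair; rewrite /= scaler0 addr0.
  rewrite {1}[u.1]basis_expand -(linfunE lin) linear_sum; apply: eq_bigr => i _.
  by rewrite linearZ /= linfunE // /dform /= ev0r addr0.
have lin : linear (fun x : vdual A => (0, x) : double A).
  by move=> k a b; congr pair; rewrite /= scaler0 addr0.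
rewrite {1}[u.2]dual_basis_expand -(linfunE lin) linear_sum; apply: eq_bigr => i _.
by rewrite linearZ /= linfunE // /dform /= ev0l add0r.
Qed.

Lemma double_expand_g u : u = \sum_s dform (fd s) u *: gd s.
Proof.
rewrite [LHS]double_expand_f !big_sumType /= addrC.
by congr (_ + _); apply: eq_bigr => i _; rewrite dformC.
Qed.

Lemma sym_part_sum : r + tflip r = \sum_s tpure (fd s) (gd s).
Proof.
rewrite big_sumType /= /tflip tlift_sum //; first exact: tpure_linr.
by move=> w k a b; apply: tpure_linl.
Qed.

(** The symmetric part is half the Casimir tensor of [dform], so [dual_bases_adjoint] applies. *)
Lemma sym_part_adjoint (f g : 'End(double A)) :
    (forall u v, dform (f u) v = dform u (g v)) ->
  tmap f \1%VF (sym_part r) = tmap \1%VF g (sym_part r).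
Proof.
move=> adj; rewrite /sym_part !tmapZ sym_part_sum !tmap_sum; congr (_ *: _).
under eq_bigr do rewrite id_lfunE; under [RHS]eq_bigr do rewrite id_lfunE.
apply: (dual_bases_adjoint (F := @tpure _ _ _) double_expand_f double_expand_g _ _ adj).
  by move=> w; apply: tpure_linl.
exact: tpure_linr.
Qed.

Lemma canonical_adjoint (U : vectType K) (F : double A -> double A -> U)
    (phi : 'End(A)) (psi : 'End(vdual A)) :
    (forall w, linear (F^~ w)) -> (forall v, linear (F v)) ->
    (forall a x, ev x (phi a) = ev (psi x) a) ->
  \sum_(i < n) F (phi e`_i, 0) (0, es i) = \sum_(i < n) F (e`_i, 0) (0, psi (es i)).
Proof.
move=> Fl Fr adj; pose G (a : A) (x : vdual A) := F (a, 0) (0, x).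
apply: (@dual_bases_adjoint K A (vdual A) U _ (fun i : 'I_n => e`_i) es
         (fun a x => ev x a) G phi psi) => //.
- exact: basis_expand.
- exact: dual_basis_expand.
- move=> x k a b; rewrite -Fl /G; congr F.
  by congr pair; rewrite /= scaler0 addr0.
move=> a k x y; rewrite -Fr /G; congr F.
by congr pair; rewrite /= scaler0 addr0.
Qed.

(** * Pairings of r acted on by an invariant product, read through I_r *)

Section InvariantProduct.
Variable m : 'Hom(double A, 'End(double A)).
Hypothesis m_inv : forall u v w, dform (m u v) w = dform u (m v w).

Lemma tpair_canonical_right u f g :
  tpair (tmap \1%VF (m u) r) f g = dform u (m (0, (I_map r f).2) (I_map r g)).
Proof.
pose phi (x : vdual A) : K^o := dform u (m (0, x) (I_map r g)).
have phi_lin : linear phi.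
  move=> k x y; rewrite /phi -dform_linear; congr dform.
  rewrite -scale_lfunE -add_lfunE -linearP; congr (m _ _).
  by congr pair; rewrite /= scaler0 addr0.
rewrite tmap_sum tpair_sum -[RHS]/(phi _) -(dual_basis_sum _ phi_lin).
apply: eq_bigr => i _; rewrite id_lfunE; congr (_ * _).
  by rewrite -dform_I_map /dform /= ev0l addr0.
by rewrite -dform_I_map m_inv.
Qed.

Lemma tpair_canonical_left u f g :
  tpair (tmap (m u) \1%VF r) f g = dform u (m ((I_map r g).1, 0) (I_map r f)).
Proof.
pose phi (a : A) : K^o := dform u (m (a, 0) (I_map r f)).
have phi_lin : linear phi.
  move=> k x y; rewrite /phi -dform_linear; congr dform.
  rewrite -scale_lfunE -add_lfunE -linearP; congr (m _ _).
  by congr pair; rewrite /= scaler0 addr0.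
rewrite tmap_sum tpair_sum -[RHS]/(phi _) -(basis_sum _ phi_lin).
apply: eq_bigr => i _; rewrite id_lfunE; congr (_ * _).
  by rewrite -dform_I_map m_inv.
by rewrite -dform_I_map /dform /= ev0r add0r.
Qed.

End InvariantProduct.

(** * Quasi-triangularity of the double *)

Section Bialgebra.
Variables (br mul : 'Hom(A, 'End(A))).
Variables (brD mulD : 'Hom(vdual A, 'End(vdual A))).
Hypothesis bialgA : poisson_bialgebra br mul brD mulD.

Let dbr := double_br br brD.
Let dmul := double_mul mul mulD.

Lemma sym_part_invariant : adL_invariant dbr dmul (sym_part r).
Proof.
move=> u; split.
  (* For [dform], the adjoint of ad(u) is -ad(u), while L(u) is self-adjoint. *)
  rewrite (sym_part_adjoint (g := - dbr u)) => [|v w].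
    have tN t : tmap \1%VF (- dbr u) t = - tmap \1%VF (dbr u) t.
      rewrite /tmap /tlift -sumrN; apply: eq_bigr => i _.
      rewrite -sumrN; apply: eq_bigr => j _; rewrite opp_lfunE -scalerN.
      by rewrite tpureNr.
    by rewrite tN addNr.
  by rewrite opp_lfunE dformNr (double_brC bialgA) dformNl (dform_br bialgA).
rewrite (sym_part_adjoint (g := dmul u)) ?subrr // => v w.
by rewrite (double_mulC bialgA) (dform_mul bialgA).
Qed.

Lemma tpure_bilinear_r (B : vectType K) (u : B) :
  (forall w : B, linear (fun v : B => tpure u (tpure v w))) /\
  (forall v : B, linear (fun w : B => tpure u (tpure v w))).
Proof.
split=> v; apply: tpure_linear_r; [exact: tpure_linl | exact: tpure_linr].
Qed.

Lemma tpure_bilinear_l (B : vectType K) (u : B) :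
  (forall w : B, linear (fun v : B => tpure v (tpure w u))) /\
  (forall v : B, linear (fun w : B => tpure v (tpure w u))).
Proof.
by split=> v; [exact: tpure_linl | apply: tpure_linear_r; apply: tpure_linl].
Qed.

(* The mixed product of e_i^* and e_j has an A-part and an A^*-part; after
   transposition (dual_adj, adj) the former cancels the term with the product
   of e_i^* and e_j^*, the latter the term with the product of e_i and e_j. *)
Lemma canonical_pybe : pybe_solution dbr dmul r.
Proof.
have PA := bialg_poisson bialgA.
have sN (u : A) : (- u, 0) = - (u, 0) :> double A by congr pair; rewrite /= oppr0.
have dual_adj h (u : double A) :
    \sum_(j < n) tpure u
      (tpure ((transpose_dual h e`_j, 0) : double A) ((0, es j) : double A)) =
    \sum_(j < n) tpure u
      (tpure ((e`_j, 0) : double A) ((0, h (es j)) : double A)).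
  have [Fl Fr] := tpure_bilinear_r u.
  by apply: (canonical_adjoint Fl Fr) => a x; rewrite ev_transpose_dual.
have adj h (u : double A) :
    \sum_(j < n) tpure ((e`_j, 0) : double A)
      (tpure ((0, transpose h (es j)) : double A) u) =
    \sum_(j < n) tpure ((h e`_j, 0) : double A)
      (tpure ((0, es j) : double A) u).
  have [Fl Fr] := tpure_bilinear_l u.
  by symmetry; apply: (canonical_adjoint Fl Fr) => a x; rewrite ev_transpose.
split.
  rewrite C_ofE /C_term -/dbr -/es.
  under eq_bigr do rewrite !big_split /=.
  rewrite !big_split /=.
  have split_lr i j : dbr (0, es i) (e`_j, 0) =
      - (transpose_dual (brD (es i)) e`_j, 0) + (0, transpose (br e`_j) (es i)).
    by rewrite (double_br_pure br brD) -sN [LHS]double_split.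
  under [X in _ + X]eq_bigr => i _ do under eq_bigr => j _ do
    rewrite split_lr tpureDl tpureNl tpureDr tpureNr.
  under [X in _ + X]eq_bigr => i _ do rewrite big_split /= sumrN dual_adj.
  (* [adj] acts on the index i, so the sum over i is made the inner one. *)
  rewrite [X in _ + X]big_split /= [X in _ + (_ + X)]exchange_big /=.
  under [X in _ + (_ + X)]eq_bigr => j _ do rewrite adj.
  rewrite [X in _ + (_ + X)]exchange_big sumrN addrA.
  under [X in _ + X - _]eq_bigr => i _ do under eq_bigr => j _ do
    rewrite (double_br_pure br brD).
  rewrite addrK -big_split big1 //= => i _; rewrite -big_split big1 //= => j _.
  by rewrite (double_br_pure br brD) -tpureDl (lie_anti PA) sN addNr tpure0l.
rewrite A_ofE /A_term -/dmul -/es.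
under eq_bigr do rewrite sumrB big_split /=.
rewrite sumrB big_split /=.
have split_lr i j : dmul (e`_j, 0) (0, es i) =
    (transpose_dual (mulD (es i)) e`_j, 0) + (0, transpose (mul e`_j) (es i)).
  by rewrite (double_mul_pure mul mulD) [LHS]double_split.
under [X in _ - X]eq_bigr => i _ do under eq_bigr => j _ do
  rewrite split_lr tpureDl tpureDr.
under [X in _ - X]eq_bigr => i _ do rewrite big_split /= dual_adj.
rewrite [X in _ - X]big_split /= [X in _ - (_ + X)]exchange_big /=.
under [X in _ - (_ + X)]eq_bigr => j _ do rewrite adj.
rewrite [X in _ - (_ + X)]exchange_big opprD addrA.
under [X in _ + X - _ - _]eq_bigr => i _ do under eq_bigr => j _ do
  rewrite (double_mul_pure mul mulD).
rewrite addrK -sumrB big1 //= => i _; rewrite -sumrB big1 //= => j _.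
by rewrite (double_mul_pure mul mulD) (comm_mulC (poisson_comm PA)) subrr.
Qed.

(** Through I_r the dual products become componentwise: the opposites of the products of A, and the
    products of its dual. Negating both products of a Poisson algebra preserves every axiom, and
    injectivity of I_r pulls the axioms back. *)
Lemma canonical_dual_poisson :
  poisson_algebra (dual_prod (delta_of dbr r)) (dual_prod (Delta_of dmul r)).
Proof.
have [altA jacA] := poisson_lie (bialg_poisson bialgA).
have [mC mA] := poisson_comm (bialg_poisson bialgA).
have lei := poisson_leibniz (bialg_poisson bialgA).
have [altD jacD] := poisson_lie (bialg_dual_poisson bialgA).
have [mDC mDA] := poisson_comm (bialg_dual_poisson bialgA).
have leiD := poisson_leibniz (bialg_dual_poisson bialgA).
have bE f g : I_map r (dual_prod (delta_of dbr r) f g) =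
    (- br (I_map r f).1 (I_map r g).1, brD (I_map r f).2 (I_map r g).2).
  apply: dform_sep => u; rewrite dformC dform_I_map dual_prodE delta_ofE tpairD.
  rewrite (tpair_canonical_right (dform_br bialgA)).
  rewrite (tpair_canonical_left (dform_br bialgA)) -dformDr dformC; congr dform.
  move: (I_map r f) (I_map r g) => [p1 p2] [q1 q2] /=.
  rewrite (double_split (q1, q2)) (double_split (p1, p2)) !linearD /=.
  (* The two mixed brackets of q1 with p2 cancel, which leaves one bracket inside A and one inside
     the dual. *)
  rewrite (double_brC bialgA (q1, 0) (0, _)) addrACA addrC.
  rewrite addrA subrK !(double_br_pure br brD).
  by congr pair; rewrite /= ?addr0 ?add0r // (lie_anti (bialg_poisson bialgA)).
have mE f g : I_map r (dual_prod (Delta_of dmul r) f g) =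
    (- mul (I_map r f).1 (I_map r g).1, mulD (I_map r f).2 (I_map r g).2).
  apply: dform_sep => u; rewrite dformC dform_I_map dual_prodE Delta_ofE tpairD tpairN.
  rewrite (tpair_canonical_right (dform_mul bialgA)).
  rewrite (tpair_canonical_left (dform_mul bialgA)) -dformNr -dformDr dformC; congr dform.
  move: (I_map r f) (I_map r g) => [p1 p2] [q1 q2] /=.
  rewrite (double_split (q1, q2)) (double_split (p1, p2)) !linearD /=.
  (* Here the mixed products cancel by commutativity and the minus sign in Delta_r. *)
  rewrite (double_mulC bialgA (q1, 0) (0, _)) (addrC (dmul (0, _) (q1, 0))).
  rewrite addrA addrAC addrK !(double_mul_pure mul mulD).
  by congr pair; rewrite /= ?subr0 ?add0r // mC.
have inj := bij_inj I_map_bij.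
split; first split.
- by move=> f; apply: inj; rewrite bE altA altD oppr0 linear0.
- move=> f g h; apply: inj; rewrite !linearD /= linear0 !bE /= !linearN /= !opprK.
  by congr pair; [exact: jacA | exact: jacD].
- split=> [f g|f g h]; apply: inj; rewrite !mE /=; first by rewrite mC mDC.
  by rewrite !(bilinNl, linearN) /= !opprK mA mDA.
move=> f g h; apply: inj; rewrite linearD /= !(bE, mE) /= leiD.
by rewrite !(bilinNl, linearN) /= !opprK lei.
Qed.

Lemma canonical_quasi_triangular : quasi_triangular dbr dmul r.
Proof.
split; [|exact: canonical_pybe|exact: sym_part_invariant].
apply: coboundary_poisson_bialgebra; first exact: double_poisson.
exact: canonical_dual_poisson.
Qed.

End Bialgebra.
End CanonicalTensor.

Theorem theorem3p4 (K : fieldType) (charK0 : [pchar K]%R =i pred0)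
  (A : vectType K) (br mul : 'Hom(A, 'End(A)))
  (brD mulD : 'Hom(vdual A, 'End(vdual A)))
  (bialgA : poisson_bialgebra br mul brD mulD)
  (n : nat) (e : n.-tuple A) (e_basis : basis_of fullv e) :
  quasi_triangular (double_br br brD) (double_mul mul mulD) (canonical_r e) /\
  factorizable (double_br br brD) (double_mul mul mulD) (canonical_r e).
Proof.
have qt := canonical_quasi_triangular e_basis bialgA.
by split; [|split; [|exact: I_map_bij]].
Qed.
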